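(* Let $G\cong\mathbb{Z}_k\rtimes_n\mathbb{Z}_{ql}$ and $d=\sum_{h=0}^{q-1}n^h$. Let $i,j\in\mathbb{Z}$ with $a^i\notin Z(G)$ and $q\mid j$, so that $C_G(a^ib^j)=\langle a,b^q\rangle$. Let $r,s\in\mathbb{Z}$ and let $\chi_{r,s}$ be the irreducible character of $\langle a,b^q\rangle$ given by $\chi_{r,s}(a^xb^{qy})=\mu_k^{rx}\mu_l^{sy}$, where $\mu_k,\mu_l$ are fixed primitive $k$-th and $l$-th roots of unity. Let $V=M(\mathrm{class}(a^ib^j),\chi_{r,s})$ be the corresponding irreducible $\mathcal{D}(G)$-module, and let $m\in\mathbb{N}$. (i) If $ql\nmid mj$, then $\nu_m(V)=0$. (ii) If $q\nmid l$ and $ql\mid mj$, then $$\nu_m(V)=\begin{cases} q & \text{if } q\mid m,\ k\mid mi,\ k\mid mr,\ lq\mid ms,\\ q-1 & \text{if } q\mid m,\ (k\nmid mi \text{ or } k\nmid mr),\ kq\mid mdi,\ kq\mid mdr,\ lq\mid ms,\\ 1 & \text{if } (q\nmid m \text{ or } lq\nmid ms),\ k\mid mi,\ k\mid mr,\ l\mid ms,\\ 0 & \text{otherwise.}\end{cases}$$ (iii) If $q\mid l$ and $ql\mid mj$, then $$\nu_m(V)=\begin{cases} q & \text{if } q\mid m,\ k\mid mi,\ k\mid mr,\ lq\mid ms,\\ q-1 & \text{if } q\mid m,\ (k\nmid mr \text{ or } k\nmid mi),\ kq\mid mdi,\ kq\mid mdr,\ lq\mid ms,\\ 1 & \text{if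 } q\nmid m,\ k\mid mi,\ k\mid mr,\ l\mid ms,\\ -1 & \text{if } q\mid m,\ (k\nmid mi \text{ or } k\nmid mr),\ lq\nmid ms,\ kq\mid mdi,\ kq\mid mdr,\ l\mid ms,\\ 0 & \text{otherwise.}\end{cases}$$
   Context: $\mathbb{N}=\{1,2,3,\dots\}$. Let $k,q,l,n\in\mathbb{N}$ with $q$ a prime dividing $|\mathrm{Aut}(\mathbb{Z}_k)|$, $n^q\equiv 1\bmod k$ and $n\not\equiv 1\bmod k$. Then $\mathbb{Z}_k\rtimes_n\mathbb{Z}_{ql}$ denotes the (non-abelian, order $kql$) group $\langle a,b\mid a^k=b^{ql}=1,\ bab^{-1}=a^n\rangle$. For a finite group $G$, the Drinfel'd double $\mathcal{D}(G)$ is the complex Hopf algebra with basis $\{p_g\bowtie x : g,x\in G\}$, multiplication $(p_g\bowtie x)(p_h\bowtie y)=\delta_{g,xhx^{-1}}\,p_g\bowtie xy$, unit $\sum_g p_g\bowtie 1$, comultiplication $\Delta(p_g\bowtie x)=\sum_{uv=g}(p_u\bowtie x)\otimes(p_v\bowtie x)$ and counit $\epsilon(p_g\bowtie x)=\delta_{g,1}$. Its integral with counit value 1 is $\Lambda=\frac{1}{|G|}\sum_{x\in G}p_1\bowtie x$. Put $\Lambda^{[m]}=\sum\Lambda_1\Lambda_2\cdots\Lambda_m$ (the product of the $m$ tensor factors of the iterated comultiplication of $\Lambda$). For a finite-dimensional $\mathcal{D}(G)$-module $V$ with character $\chi$, the $m$-th indicator is $\nu_m(V)=\chi(\Lambda^{[m]})$.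 For $t\in G$ and an irreducible representation (or its character) $\rho$ of $C_G(t)$ on a space $W$, the irreducible module $M(\mathrm{class}(t),\rho)$ is defined as follows. Write $\mathrm{class}(t)=\{t_1,\dots,t_N\}$ for the conjugacy class and $t_i=g_itg_i^{-1}$. Then $M(\mathrm{class}(t),\rho)=\bigoplus_{i=1}^N g_i\otimes W$, with $p_h\bowtie 1$ acting by $g_i\otimes w\mapsto\delta_{h,t_i}\,g_i\otimes w$, and $x\in G$ acting by $g_i\otimes w\mapsto g_j\otimes\rho(\gamma)w$ where $xg_i=g_j\gamma$ with $\gamma\in C_G(t)$. *)

(* Defs.v *)
From HB Require Import structures.
From mathcomp Require Import all_boot all_order all_algebra all_fingroup.
From mathcomp Require Import all_solvable mxrepresentation.

Set Implicit Arguments.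
Unset Strict Implicit.
Unset Printing Implicit Defensive.

Import GRing.Theory.
Local Open Scope ring_scope.

Definition expgz (gT : finGroupType) (x : gT) (z : int) : gT :=
  match z with Posz c => x ^+ c | Negz c => x ^- c.+1 end%g.

(* The whole group gT is isomorphic to Z_k \rtimes_n Z_c, with a and b
   corresponding to the generators of the presentation: since the group is
   finite, any generating pair that satisfies the defining relations
   corresponds to them under some isomorphism. *)
Definition semidirect_gens (gT : finGroupType) (k n c : nat) (a b : gT) : Prop :=
  [/\ [set: gT] \isog Grp (x : y : x ^+ k, y ^+ c, y * x * y^-1 = x ^+ n),
      <<[set a; b]>> = [set: gT],
      a ^+ k = 1,
      b ^+ c = 1
    & b * a * b^-1 = a ^+ n]%g.

Section FreeSpace.
Variables (F : fieldType) (I : finType).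

Definition bvec (i : I) : {ffun I -> F^o} := [ffun j => (j == i)%:R].

(* linear extension of a function given on the basis *)
Definition lext (V : lmodType F) (f : I -> V) (u : {ffun I -> F^o}) : V :=
  \sum_i u i *: f i.

Lemma lext_is_linear (V : lmodType F) (f : I -> V) : linear (lext f).
Proof.
move=> c u v; rewrite /lext scaler_sumr -big_split; apply: eq_bigr => i _ /=.
by rewrite !ffunE scalerDl scalerA.
Qed.
HB.instance Definition _ (V : lmodType F) (f : I -> V) :=
  GRing.isLinear.Build F {ffun I -> F^o} V _ (lext f) (lext_is_linear f).

Lemma lext_bvec (V : lmodType F) (f : I -> V) i : lext f (bvec i) = f i.
Proof.
rewrite /lext (bigD1 i) //= ffunE eqxx scale1r big1 ?addr0 // => j ne_ji.
by rewrite ffunE (negbTE ne_ji) scale0r.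
Qed.

Lemma bvec_expand (u : {ffun I -> F^o}) : u = \sum_i u i *: bvec i.
Proof.
apply/ffunP => j; rewrite sum_ffunE (bigD1 j) //= !ffunE eqxx.
rewrite big1 ?addr0 => [|i ne_ij]; first by rewrite [_ *: _]mulr1.
by rewrite !ffunE eq_sym (negbTE ne_ij) [_ *: _]mulr0.
Qed.

End FreeSpace.

Section Drinfeld.
Variables (gT : finGroupType) (F : fieldType).

(* The pair (g, x) indexes the basis vector p_g \bowtie x. *)
Definition drinfeld : Type := {ffun gT * gT -> F^o}.
HB.instance Definition _ := GRing.Lmodule.copy drinfeld {ffun gT * gT -> F^o}.

Definition dbasis (g x : gT) : drinfeld := bvec F (g, x).

Definition dmul (u v : drinfeld) : drinfeld :=
  lext (fun c => lext (fun e =>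
    (c.1 == c.2 * e.1 * c.2^-1)%g%:R *: dbasis c.1 (c.2 * e.2)%g) v) u.

Definition dunit : drinfeld := \sum_g dbasis g 1%g.

Lemma dmulDl : left_distributive dmul +%R.
Proof. by move=> u v w; exact: (linearD (lext _)). Qed.

Lemma dmulZl c u v : dmul (c *: u) v = c *: dmul u v.
Proof. exact: (linearZZ (lext _)). Qed.

Lemma dmulE u v : dmul u v = \sum_c u c *: lext (fun e =>
  (c.1 == c.2 * e.1 * c.2^-1)%g%:R *: dbasis c.1 (c.2 * e.2)%g) v.
Proof. by []. Qed.

Lemma dmulDr : right_distributive dmul +%R.
Proof.
move=> u v w; rewrite !dmulE -big_split; apply: eq_bigr => c _ /=.
by rewrite -scalerDr; congr (_ *: _); exact: (linearD (lext _)).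
Qed.

Lemma dmulZr c u v : dmul u (c *: v) = c *: dmul u v.
Proof.
rewrite !dmulE scaler_sumr; apply: eq_bigr => e _ /=.
rewrite scalerA mulrC -scalerA; congr (_ *: _).
exact: (linearZZ (lext _)).
Qed.

Lemma dmul0l v : dmul 0 v = 0.
Proof. by have := dmulZl 0 0 v; rewrite !scale0r. Qed.

Lemma dmul0r v : dmul v 0 = 0.
Proof. by have := dmulZr 0 v 0; rewrite !scale0r. Qed.

Lemma dmul_suml J (s : seq J) (f : J -> drinfeld) v :
  dmul (\sum_(i <- s) f i) v = \sum_(i <- s) dmul (f i) v.
Proof. exact: (linear_sum (lext _)). Qed.

Lemma dmul_sumr J (s : seq J) (f : J -> drinfeld) u :
  dmul u (\sum_(i <- s) f i) = \sum_(i <- s) dmul u (f i).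
Proof.
elim: s => [|i s IHs]; last by rewrite !big_cons dmulDr IHs.
by rewrite !big_nil dmul0r.
Qed.

Lemma dmul_basis g x h y :
  dmul (dbasis g x) (dbasis h y) =
    (g == x * h * x^-1)%g%:R *: dbasis g (x * y)%g.
Proof. by rewrite /dmul /dbasis !lext_bvec. Qed.

Lemma drinfeld_ind (P : drinfeld -> Prop) :
    (forall g x, P (dbasis g x)) ->
    (forall c u, P u -> P (c *: u)) -> P 0 ->
    (forall u v, P u -> P v -> P (u + v)) ->
  forall u, P u.
Proof.
move=> Pb PZ P0 PD u; rewrite (bvec_expand u); apply: big_ind => // -[g x] _.
exact/PZ/Pb.
Qed.

Lemma dmulA : associative dmul.
Proof.
move=> u v w.
elim/drinfeld_ind: u => [g x|c u IH||u u' IH IH']; last 3 first.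
- by rewrite !dmulZl IH.
- by rewrite !dmul0l.
- by rewrite !dmulDl IH IH'.
elim/drinfeld_ind: v => [h y|c v IH||v v' IH IH']; last 3 first.
- by rewrite dmulZl !dmulZr dmulZl IH.
- by rewrite dmul0r !dmul0l dmul0r.
- by rewrite dmulDl !dmulDr dmulDl IH IH'.
elim/drinfeld_ind: w => [e z|c w IH||w w' IH IH']; last 3 first.
- by rewrite !dmulZr IH.
- by rewrite !dmul0r.
- by rewrite !dmulDr IH IH'.
rewrite !dmul_basis dmulZr dmulZl !dmul_basis !scalerA -!natrM !mulnb mulgA.
congr (_%:R *: _); have [-> | ne_g] /= := eqVneq g (x * h * x^-1)%g.
  rewrite andbT invMg !mulgA (inj_eq (mulIg _)) -!mulgA.
  by rewrite (inj_eq (mulgI _)).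
by rewrite andbF.
Qed.

Lemma dmul1l : left_id dunit dmul.
Proof.
move=> u; elim/drinfeld_ind: u => [h y|c u IH||u v IH IH']; last 3 first.
- by rewrite dmulZr IH.
- by rewrite dmul0r.
- by rewrite dmulDr IH IH'.
rewrite /dunit dmul_suml (bigD1 h) //= dmul_basis !mul1g invg1 mulg1 eqxx.
rewrite scale1r big1 ?addr0 // => g ne_gh.
by rewrite dmul_basis mul1g invg1 mulg1 (negbTE ne_gh) scale0r.
Qed.

Lemma dmul1r : right_id dunit dmul.
Proof.
move=> u; elim/drinfeld_ind: u => [h y|c u IH||u v IH IH']; last 3 first.
- by rewrite dmulZl IH.
- by rewrite dmul0l.
- by rewrite dmulDl IH IH'.
rewrite /dunit dmul_sumr (bigD1 (h ^ y)%g) //= dmul_basis mulg1 conjgE.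
rewrite !mulgA mulgV mul1g mulgK eqxx scale1r big1 ?addr0 // => g ne_g.
rewrite dmul_basis; case: eqP => [def_h | _]; last by rewrite scale0r.
by case/eqP: ne_g; rewrite def_h !mulgA mulVg mul1g mulgKV.
Qed.

Lemma dunit_neq0 : dunit != 0.
Proof.
apply/eqP => /(congr1 (fun u : drinfeld => u (1, 1)%g)) /eqP.
rewrite /dunit sum_ffunE (bigD1 1%g) //= !ffunE eqxx big1 ?addr0 => [|g ne_g1].
  by rewrite oner_eq0.
by rewrite ffunE xpair_eqE eq_sym (negbTE ne_g1).
Qed.

HB.instance Definition _ := GRing.Zmodule_isNzRing.Build drinfeld
  dmulA dmul1l dmul1r dmulDl dmulDr dunit_neq0.

Lemma drinfeld_scaleAl c (u v : drinfeld) : c *: (u * v) = (c *: u) * v.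
Proof. by rewrite [RHS]dmulZl. Qed.
Lemma drinfeld_scaleAr c (u v : drinfeld) : c *: (u * v) = u * (c *: v).
Proof. by rewrite [RHS]dmulZr. Qed.
HB.instance Definition _ :=
  GRing.Lmodule_isLalgebra.Build F drinfeld drinfeld_scaleAl.
HB.instance Definition _ :=
  GRing.Lalgebra_isAlgebra.Build F drinfeld drinfeld_scaleAr.

(* The tensor square is the space with basis (gT * gT) * (gT * gT), and the
   m-th tensor power is the space with basis m.-tuple (gT * gT). *)
Definition comul : drinfeld -> {ffun (gT * gT) * (gT * gT) -> F^o} :=
  lext (fun c => \sum_(uv : gT * gT | (uv.1 * uv.2)%g == c.1)
                   bvec F ((uv.1, c.2), (uv.2, c.2))).

Definition counit : drinfeld -> F^o := lext (fun c => (c.1 == 1%g)%:R).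

(* m tensor factors; the successor case is (id \otimes Delta^(m)) \o Delta *)
Fixpoint iter_comul (m : nat) (z : drinfeld) :
    {ffun m.-tuple (gT * gT) -> F^o} :=
  match m with
  | 0 => counit z *: bvec F [tuple]
  | m'.+1 =>
      lext (fun c : (gT * gT) * (gT * gT) =>
              lext (fun t : m'.-tuple (gT * gT) => bvec F [tuple of c.1 :: t])
                   (iter_comul m' (bvec F c.2)))
           (comul z)
  end.

Lemma counit_basis g x : counit (dbasis g x) = (g == 1%g)%:R.
Proof. by rewrite /counit lext_bvec. Qed.

Lemma iter_comul1 c : iter_comul 1 (bvec F c) = bvec F [tuple c].
Proof.
rewrite /= /comul lext_bvec linear_sum /= (bigD1 (c.1, 1%g)) /= ?mulg1 //.
rewrite big1 => [|[u v] /= /andP[/eqP uv_c ne_uv]].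
  rewrite addr0 !lext_bvec (counit_basis 1%g c.2) (eqxx (1%g : gT)) scale1r.
  by rewrite lext_bvec -surjective_pairing.
rewrite lext_bvec /= (counit_basis v c.2); case: eqP => [v1 | _].
  by case/eqP: ne_uv; rewrite -uv_c v1 mulg1.
by rewrite scale0r linear0.
Qed.

Definition tensor_mul (m : nat) : {ffun m.-tuple (gT * gT) -> F^o} -> drinfeld :=
  lext (fun t : m.-tuple (gT * gT) => \prod_(c <- t) dbasis c.1 c.2).

(* z^[m] = \sum z_1 z_2 ... z_m *)
Definition sweedler_power (m : nat) (z : drinfeld) : drinfeld :=
  tensor_mul (iter_comul m z).

Definition dintegral : drinfeld :=
  #|gT|%:R^-1 *: \sum_x dbasis 1%g x.

(* A finite-dimensional module is given by the matrices, acting on column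
   vectors, of a representation of the algebra. *)
Definition indicator (m d : nat) (V : {lrmorphism drinfeld -> 'M[F]_d}) : F :=
  \tr (V (sweedler_power m dintegral)).

End Drinfeld.

(* A choice of elements g_i for which the g_i t g_i^-1 enumerate without
   repetition the conjugacy class of t. *)
Structure class_reps (gT : finGroupType) (t : gT) := ClassReps {
  class_size : nat;
  class_rep :> 'I_class_size -> gT;
  class_rep_inj : injective (fun i => class_rep i * t * (class_rep i)^-1)%g;
  class_repE : (t ^: [set: gT])%g =
    [set (class_rep i * t * (class_rep i)^-1)%g | i : 'I_class_size]
}.

Section ClassModule.
Variables (gT : finGroupType) (F : fieldType) (t : gT) (g : class_reps t).
Variables (d : nat) (rho : mx_representation F 'C[t]%g d).

Local Notation N := (class_size g).
Local Notation V := (\sum_(i < N) d)%N.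

(* x maps g_i \otimes w to g_j \otimes rho(g_j^-1 x g_i) w for the j with
   g_j^-1 x g_i in C(t), and p_h keeps the result iff h = g_j t g_j^-1;
   p_h \bowtie x = (p_h \bowtie 1) (\sum_u p_u \bowtie x) does both in turn. *)
Definition class_block (h x : gT) (j i : 'I_N) : 'M[F]_d :=
  let y := ((g j)^-1 * x * g i)%g in
  if (y \in 'C[t]%g) && (h == g j * t * (g j)^-1)%g then rho y else 0.

Definition class_module (z : drinfeld gT F) : 'M[F]_V :=
  lext (fun c => \mxblock_(j < N, i < N) class_block c.1 c.2 j i) z.

Lemma class_module_is_linear : linear class_module.
Proof. exact: (linearP (lext _)). Qed.
HB.instance Definition _ := GRing.isLinear.Build F (drinfeld gT F) 'M[F]_V _
  class_module class_module_is_linear.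

Lemma class_module_basis h x :
  class_module (dbasis F h x) = \mxblock_(j < N, i < N) class_block h x j i.
Proof. exact: lext_bvec. Qed.

Lemma class_rep_cent i j : ((g j)^-1 * g i \in 'C[t])%g = (i == j).
Proof.
apply/cent1P/eqP => [eq_t|->]; last first.
  by rewrite /commute mulVg mulg1 mul1g.
apply: (@class_rep_inj _ _ g i j); rewrite /= -[g i](mulKVg (g j)) invMg -!mulgA.
by congr (_ * _)%g; rewrite !mulgA eq_t mulgK.
Qed.

Lemma class_rep_ex (x : gT) i :
  exists j : 'I_N, ((g j)^-1 * x * g i)%g \in 'C[t]%g.
Proof.
have: (x * g i * t * (x * g i)^-1)%g \in (t ^: [set: gT])%g.
  by apply/imsetP; exists (x * g i)^-1%g; rewrite ?inE // conjgE invgK !mulgA.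
rewrite (class_repE g) => /imsetP[j _ def_j]; exists j.
apply/cent1P; rewrite /commute -(mulgA _ x); move: (x * g i)%g def_j => y def_j.
by apply: (mulgI (g j)); rewrite !mulgA mulgV mul1g -def_j mulgKV.
Qed.

Lemma class_module_mul_basis h x h' y :
  class_module (dbasis F h x * dbasis F h' y) =
    class_module (dbasis F h x) * class_module (dbasis F h' y).
Proof.
rewrite [X in class_module X]dmul_basis linearZ /= !class_module_basis.
have scale_mxblock c B :
    c *: (\mxblock_(j < N, i < N) B j i : 'M[F]_V) = \mxblock_(j, i) (c *: B j i).
  by apply/matrixP => u v; rewrite !mxE.
rewrite [RHS]mul_mxblock scale_mxblock; apply: eq_mxblock => k i.
have [j Cj] := class_rep_ex y i.
rewrite (bigD1 j) //= big1 ?addr0 => [|j' ne_j']; last first.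
  rewrite [X in _ *m X]/class_block ifF ?mulmx0 //; apply/negP => /andP[Cj' _].
  case/eqP: ne_j'; apply/eqP; rewrite -class_rep_cent.
  by have:= groupM Cj (groupVr Cj'); rewrite !invMg invgK !mulgA !mulgK.
have Dxy : ((g k)^-1 * (x * y) * g i
            = (g k)^-1 * x * g j * ((g j)^-1 * y * g i))%g.
  by rewrite !mulgA mulgK.
rewrite /class_block Dxy groupMr // Cj /=.
have [Ck /= | _] := boolP (_ \in _); last by rewrite mul0mx scaler0.
have [-> | _] /= := eqVneq h (g k * t * (g k)^-1)%g; last first.
  by rewrite mul0mx scaler0.
suff ->: (g k * t * (g k)^-1 == x * h' * x^-1)%g = (h' == g j * t * (g j)^-1)%g.
  case: eqP => _; last by rewrite mulmx0 scale0r.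
  by rewrite scale1r repr_mxM.
have ->: (g k * t * (g k)^-1 = x * (g j * t * (g j)^-1) * x^-1)%g.
  have /cent1P comm_t := Ck.
  have ->: x = (g k * ((g k)^-1 * x * g j) * (g j)^-1)%g.
    by rewrite !mulgA mulgV mul1g mulgK.
  move: (_ * g j)%g comm_t => z comm_t.
  rewrite !invMg invgK !mulgA !mulgKV -(mulgA (g k) z t) comm_t.
  by rewrite !mulgA mulgK.
by rewrite (inj_eq (mulIg _)) (inj_eq (mulgI _)) eq_sym.
Qed.

Lemma class_module_is_monoid_morphism : monoid_morphism class_module.
Proof.
split=> [|u v].
  rewrite [X in class_module X]/(1 : drinfeld gT F) [LHS]linear_sum /=.
  rewrite (eq_bigr _ (fun h _ => class_module_basis h 1%g)) -mxblock_sum.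
  rewrite -[RHS]mxdiagZ; apply/mxblockP => j i.
  rewrite !mxblockK (bigD1 (g j * t * (g j)^-1)%g) //= big1 => [|h ne_h].
    rewrite addr0 /class_block mulg1 class_rep_cent eqxx andbT eq_sym.
    by case: eqP => // ->; rewrite mulVg repr_mx1 conform_mx_id.
  by rewrite /class_block (negbTE ne_h) andbF.
elim/drinfeld_ind: u => [h x|c u IH||u u' IH IH']; last 3 first.
- by rewrite -scalerAl !linearZ /= IH; exact: scalemxAl.
- by rewrite mul0r linear0 mul0r.
- by rewrite mulrDl !linearD /= IH IH' mulrDl.
elim/drinfeld_ind: v => [h' y|c v IH||v v' IH IH']; last 3 first.
- by rewrite -scalerAr !linearZ /= IH; exact: scalemxAr.
- by rewrite mulr0 linear0 mulr0.
- by rewrite mulrDr !linearD /= IH IH' mulrDr.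
exact: class_module_mul_basis.
Qed.
HB.instance Definition _ := GRing.isMonoidMorphism.Build (drinfeld gT F) 'M[F]_V
  class_module class_module_is_monoid_morphism.

End ClassModule.

(* Main.v *)
(** With [t = a^i b^j], expanding [Lambda^[m]] and conjugating all class
    representatives to [t] gives
      [nu_m(V) = 1/|C(t)| \sum_(z | (t z)^m = z^m) chi(z^m)].
    For [z = a^u b^v] one has [z^m = a^(u S_v) b^(v m)] with
    [S_v = \sum_(h < m) n^(v h)], so the condition on [z] reads [k | i S_v] and
    [ql | m j]; it does not involve [u], and the sum over [u] is geometric.
    Modulo [k], [S_v] is [m] when [q | v] and [(m/q) d] when [q | m] and [q]
    does not divide [v]; in the remaining case [k | i S_v] would put [a^i] in
    the center. What is left is two geometric sums of roots of unity, over all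
    [v < ql] and over the multiples of [q]. *)
Require Import Defs.
From HB Require Import structures.
From mathcomp Require Import all_boot all_order all_algebra all_fingroup.
From mathcomp Require Import all_solvable mxrepresentation.
From mathcomp Require Import complex reals ring zify.

Set Implicit Arguments.
Unset Strict Implicit.
Unset Printing Implicit Defensive.

Import GRing.Theory.
Local Open Scope ring_scope.
Local Open Scope complex_scope.

(** * Sweedler powers in the Drinfel'd double *)

Section SweedlerPower.
Variables (gT : finGroupType) (F : fieldType).

Lemma sweedler_power_is_linear m : linear (@sweedler_power gT F m).
Proof.
suff lin_comul : linear (@iter_comul gT F m).
  by move=> c u v; rewrite /sweedler_power lin_comul [LHS]linearP.
case: m => [|m] c u v /=.
  by rewrite [counit _](linearP (lext _)) scalerDl -scalerA.
by rewrite [comul _](linearP (lext _)) linearP.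
Qed.
HB.instance Definition _ m := GRing.isLinear.Build F (drinfeld gT F)
  (drinfeld gT F) _ (@sweedler_power gT F m) (sweedler_power_is_linear m).

Local Notation spow := (@sweedler_power gT F).

Lemma sweedler_powerS m g x :
  spow m.+1 (dbasis F g x) =
    \sum_u dbasis F u x * spow m (dbasis F (u^-1 * g)%g x).
Proof.
rewrite /sweedler_power /= /comul lext_bvec.
rewrite (reindex_onto (fun u => (u, u^-1 * g)%g) fst) /=; last first.
  by case=> u v /= /eqP <-; rewrite mulKg.
rewrite (eq_bigl xpredT) => [|u]; last by rewrite mulKVg !eqxx.
rewrite [X in tensor_mul X](linear_sum (lext _)) [LHS](linear_sum (lext _)).
apply: eq_bigr => u _ /=; rewrite lext_bvec /=.
rewrite -/(dbasis F _ _); move: (iter_comul _ _) => w.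
rewrite (bvec_expand w) !linear_sum mulr_sumr; apply: eq_bigr => t _ /=.
rewrite !linearZ /= -scalerAr; congr (_ *: _).
by rewrite /tensor_mul !lext_bvec /= big_cons.
Qed.

(** All tensor factors share [x], and their product vanishes unless each group label is the
    conjugate by [x] of the preceding one. So the first label [w] determines the others, and w * w^x
    * ... * w^(x^(m-1)) telescopes to (w x^-1)^m x^m. *)
Lemma sweedler_power_basis m g x :
  spow m (dbasis F g x) =
    \sum_(w | ((w * x^-1) ^+ m * x ^+ m == g)%g) dbasis F w (x ^+ m)%g.
Proof.
elim: m g => [|m IHm] g.
  (* For m = 0 the sum over all [w] is the unit of the algebra, present exactly when g = 1. *)
  rewrite /sweedler_power /= counit_basis /tensor_mul linearZ /=.
  rewrite lext_bvec big_nil.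
  rewrite (eq_bigl (fun=> g == 1%g)) => [|w];
    last by rewrite !expg0 mulg1 eq_sym.
  case: eqP => [_|_]; last by rewrite scale0r big_pred0_eq.
  by rewrite scale1r.
rewrite sweedler_powerS [RHS]big_mkcond; apply: eq_bigr => u _ /=.
(* Left multiplication by [dbasis F u x] kills every term except the one labelled [u ^ x]. *)
rewrite IHm mulr_sumr big_mkcond (bigD1 (u ^ x)%g) //= big1 ?addr0; last first.
  move=> w ne_w; case: ifP => // _; rewrite [LHS]dmul_basis.
  case: eqP => [def_u|_]; last by rewrite scale0r.
  by case/eqP: ne_w; rewrite def_u conjgE !mulgA mulVg mul1g mulgKV.
have def_u : (x * u ^ x * x^-1 = u)%g by rewrite conjgE !mulgA mulgV mul1g
  mulgK.
rewrite [_ * _]dmul_basis def_u eqxx.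
rewrite scale1r -expgS.
have ->: (u ^ x * x^-1 = (u * x^-1) ^ x)%g by rewrite !conjgE !mulgA mulgK
  mulgKV.
rewrite -conjXg conjgE -(inj_eq (mulgI u)) mulKVg !mulgA -expgS.
by rewrite -[(_ * x * x ^+ m)%g]mulgA -expgS.
Qed.
End SweedlerPower.

(** * Indicators of class modules as sums over the group *)

Lemma expMg_eqXr (gT : finGroupType) (t z : gT) m :
  (((z * t) ^+ m == z ^+ m) = ((t * z) ^+ m == z ^+ m))%g.
Proof.
(* Both sides are the alternating word z t z ... t z with [m] letters t. *)
have E : ((z * t) ^+ m * z = z * (t * z) ^+ m)%g.
  elim: m => [|m IHm]; first by rewrite !expg0 mul1g mulg1.
  by rewrite 2!expgSr [RHS]mulgA -IHm -!mulgA.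
by rewrite -(inj_eq (mulIg z)) E -expgSr expgS (inj_eq (mulgI z)).
Qed.

(** The common value of the two powers commutes with both [t * z] and [z], hence with [t]. *)
Lemma expMg_eqXr_cent (gT : finGroupType) (t z : gT) m :
  ((t * z) ^+ m == z ^+ m -> z ^+ m \in 'C[t])%g.
Proof.
move=> /eqP E; apply/cent1P; rewrite /commute.
have : commute (t * z)%g (z ^+ m)%g by rewrite -E; apply: commuteX.
rewrite /commute -!mulgA -expgS expgSr [in X in _ = X -> _]mulgA => E2.
by apply: (mulIg z); rewrite -E2 mulgA.
Qed.

Section ClassIndicator.
Variables (gT : finGroupType) (F : fieldType) (t : gT) (g : class_reps t).
Variables (d : nat) (rho : mx_representation F 'C[t]%g d).

Lemma mxtrace_class_module w y :
  \tr (class_module g rho (dbasis F w y)) =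
    \sum_(i < class_size g | ((y ^ g i)%g \in 'C[t]%g) && (w == t ^ (g i)^-1)%g)
       \tr (rho (y ^ g i)%g).
Proof.
rewrite class_module_basis mxtrace_mxblock [RHS]big_mkcond.
apply: eq_bigr => i _; rewrite /class_block !conjgE invgK !mulgA.
by case: ifP => // _; rewrite mxtrace0.
Qed.

Lemma class_size_muln : (class_size g * #|'C[t]%g|)%N = #|gT|.
Proof.
have -> : class_size g = #|(t ^: [set: gT])%g|.
  by rewrite (class_repE g) card_imset ?card_ord //; apply: class_rep_inj.
by rewrite -index_cent1 setTI -cardsT mulnC Lagrange // subsetT.
Qed.

(** In block i the label [w] is forced to be g_i t g_i^-1. Conjugating the condition on x by g_i and
    putting z = x^(g_i) t^-1 turns it into (z t)^m = z^m, and the trace is then taken at z^m. The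
    class size cancels against |G|, leaving the order of the centralizer. *)
Lemma class_module_indicator m : #|gT|%:R != 0 :> F ->
  indicator m (class_module g rho) = #|'C[t]%g|%:R^-1 *
     \sum_(z : gT | ((t * z) ^+ m == z ^+ m)%g) \tr (rho (z ^+ m)%g).
Proof.
move=> nzG; rewrite /indicator /dintegral !linearZ /=.
rewrite [X in class_module _ _ X]linear_sum.
rewrite [class_module _ _ _]linear_sum [\tr _]linear_sum /=.
pose f z := if ((t * z) ^+ m == z ^+ m)%g then \tr (rho (z ^+ m)%g) else 0.
have E x : \tr (class_module g rho (sweedler_power m (dbasis F 1%g x))) =
   \sum_(i < class_size g) f ((x ^ g i) * t^-1)%g.
  rewrite sweedler_power_basis [X in \tr X]linear_sum linear_sum /=.
  under eq_bigr => w _ do rewrite mxtrace_class_module big_mkcond /=.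
  rewrite exchange_big; apply: eq_bigr => i _ /=.
  rewrite big_mkcond (bigD1 (t ^ (g i)^-1)%g) //= big1 ?addr0 => [|w ne_w];
    last first.
    by rewrite (negbTE ne_w) andbF; case: ifP.
  rewrite eqxx andbT /f -expMg_eqXr mulgKV conjXg.
  rewrite -(conjg_eq1 _ (g i)) conjMg !conjXg conjMg conjgKV conjVg.
  have -> : (t * (x ^ g i)^-1 = (x ^ g i * t^-1)^-1)%g 
    by rewrite [RHS]invMg invgK.
  rewrite expgVn -eq_mulVg1 eq_sym; case: eqP => // def_xm.
  (* The centralizer test in the trace formula follows from the equality of powers. *)
  rewrite def_xm expMg_eqXr_cent // -expMg_eqXr mulgKV.
  by rewrite def_xm.
under eq_bigr => x _ do rewrite E.
rewrite exchange_big /=.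
(* With x = g_i (z t) g_i^-1, each i contributes the same sum over z. *)
rewrite (eq_bigr (fun=> \sum_z f z)) => [|i _]; last first.
  rewrite (reindex (fun z => ((z * t) ^ (g i)^-1)%g)) /=.
    by apply: eq_bigr => z _; rewrite conjgKV mulgK.
  by apply: onW_bij; exists (fun x => ((x ^ g i) * t^-1)%g) => x;
     rewrite ?conjgKV ?mulgK ?mulgKV ?conjgK.
rewrite sumr_const card_ord -big_mkcond -[_ *+ class_size g]mulr_natl
  [LHS]mulrA; congr (_ * _).
move: nzG; rewrite -class_size_muln natrM mulf_eq0 negb_or => /andP[nzN nzC].
by rewrite invfM mulrAC mulVf ?mul1r.
Qed.
End ClassIndicator.

(** * A permutation model bounding the group order from below *)

Section SemidirectModel.
Variables (k n c : nat).
Hypotheses (k_gt1 : (1 < k)%N) (c_gt1 : (1 < c)%N).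
Hypothesis nc_mod : (n ^ c)%N = 1%N %[mod k].

Local Notation N := (n%:R ^+ c.-1 : 'Z_k).

Let nX : n%:R ^+ c = 1 :> 'Z_k.
Proof.
by rewrite -natrX -(Zp_nat_mod k_gt1) nc_mod Zp_nat_mod.
Qed.

Let mulNn : N * n%:R = 1.
Proof. by rewrite -exprSr prednK // ltnW. Qed.

Definition rotate_fst (w : 'Z_k * 'Z_c) := (w.1 + 1, w.2).

(* Permutations compose from left to right, whence the inverse [N] of [n]. *)
Definition scale_shift (w : 'Z_k * 'Z_c) := (N * w.1, w.2 + 1).

Lemma rotate_fst_inj : injective rotate_fst.
Proof.
move=> [u v] [u' v'] E; have eq_u : u + 1 = u' + 1 := congr1 fst E.
rewrite (addIr _ eq_u).
by rewrite (congr1 snd E : v = v').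
Qed.

Lemma scale_shift_inj : injective scale_shift.
Proof.
move=> [u v] [u' v'] E; have eq_u : N * u = N * u' := congr1 fst E.
have eq_v : v + 1 = v' + 1 := congr1 snd E.
rewrite (addIr _ eq_v); congr (_, _).
by rewrite -[u]mul1r -mulNn mulrAC eq_u mulrAC mulNn mul1r.
Qed.

Let A := perm rotate_fst_inj.
Let B := perm scale_shift_inj.

Let AX x u v : (A ^+ x)%g (u, v) = (u + x%:R, v).
Proof.
elim: x => [|x IHx]; first by rewrite expg0 perm1 addr0.
by rewrite expgSr permM IHx permE /rotate_fst /= -addrA natr1.
Qed.

Let BX x u v : (B ^+ x)%g (u, v) = (N ^+ x * u, v + x%:R).
Proof.
elim: x => [|x IHx]; first by rewrite expg0 perm1 addr0 mul1r.
by rewrite expgSr permM IHx permE /scale_shift /= mulrA -exprS -addrA natr1.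
Qed.

Let BA : (B * A * B^-1 = A ^+ n)%g.
Proof.
apply: (mulIg B); rewrite mulgKV; apply/permP=> -[u v].
rewrite !permM AX !permE /rotate_fst /scale_shift /=.
by rewrite mulrDr mulNn.
Qed.

(** By the presentation, any group generated by two elements satisfying the relations is a
    homomorphic image of the whole group. The permutations [A] and [B] satisfy them, and the orbit
    of (0, 0) under the group they generate is all of Z_k x Z_c. *)
Lemma semidirect_gens_card (gT : finGroupType) (a b : gT) :
  semidirect_gens k n c a b -> (k * c <= #|gT|)%N.
Proof.
case=> isoG _ _ _ _;
pose H := <<[set A; B]>>%G.
have homH : (H \homg [set: gT])%g.
  rewrite (isoG _ H); apply/existsP; exists (A, B) => /=.
  rewrite !xpair_eqE BA eqxx andbT joing_idl joing_idr eqxx /=.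
  apply/andP; split; apply/eqP/permP=> -[u v]; rewrite perm1.
    by rewrite AX pchar_Zp // addr0.
  by rewrite BX pchar_Zp // addr0 -exprM mulnC exprM nX expr1n mul1r.
apply: leq_trans (_ : #|H| <= _)%N; last by rewrite -cardsT leq_homg.
apply: leq_trans (leq_imset_card (fun h : {perm 'Z_k * 'Z_c} => h (0, 0)) H).
rewrite -[X in (X <= _)%N](_ : #|[set: 'Z_k * 'Z_c]| = _); last first.
  by rewrite cardsT card_prod !card_ord !Zp_cast.
apply/subset_leq_card/subsetP=> -[u v] _; apply/imsetP.
(* [B ^+ v] acts first and takes (0, 0) to (0, v); then [A ^+ u] reaches (u, v). *)
exists (B ^+ v * A ^+ u)%g.
  by rewrite groupM // groupX // mem_gen // !inE eqxx ?orbT.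
by rewrite permM BX mulr0 AX !add0r !natr_Zp.
Qed.
End SemidirectModel.

(** * Geometric sums and arithmetic modulo k *)

Lemma sum_expr_unity (F : fieldType) (z : F) N : z ^+ N = 1 ->
  \sum_(u < N) z ^+ u = if z == 1 then N%:R else 0.
Proof.
move=> zN; case: eqP => [->|/eqP z1].
  under eq_bigr do rewrite expr1n.
  by rewrite sumr_const card_ord.
have := subrX1 z N; rewrite zN subrr => /esym/eqP.
by rewrite mulf_eq0 subr_eq0 (negbTE z1) => /eqP.
Qed.

Lemma sum_ord_multiples (V : nmodType) q l (f : nat -> V) : (0 < q)%N ->
  \sum_(v < q * l | (q %| v)%N) f v = \sum_(v < l) f (q * v)%N.
Proof.
move=> q_gt0.
elim: l => [|l IHl]; first by rewrite muln0 !big_ord0.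
rewrite big_ord_recr /= -IHl -!(big_mkord (fun v => (q %| v)%N) f) mulnS addnC.
(* The last q indices, from ql on, contain a single multiple of q, namely ql itself. *)
rewrite (big_cat_nat (n := (q * l)%N)) ?leq_addr //=; congr (_ + _).
rewrite big_ltn_cond; last by rewrite -[X in (X < _)%N]addn0 ltn_add2l.
rewrite dvdn_mulr // big_nat_cond big1 ?addr0 // => v.
case/andP=> /andP[lt_v v_lt] q_v.
have: (q %| v - q * l)%N by rewrite dvdn_sub ?dvdn_mulr.
by rewrite gtnNdvd ?subn_gt0 // ltn_subLR // ltnW.
Qed.

Lemma modn_sum_expn k x m :
  (x = 1 %[mod k] -> \sum_(h < m) x ^ h = m %[mod k])%N.
Proof.
move=> x1; elim: m => [|m IHm]; first by rewrite big_ord0.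
by rewrite big_ord_recr /= -modnDm IHm -modnXm x1 modnXm exp1n modnDm addn1.
Qed.

(** Powers of [n] modulo [k] depend only on the exponent modulo [q], and multiplication by [v]
    permutes the residues modulo the prime [q]. So the sum consists of [m] full periods, each
    congruent to the sum of n^h over h < q. *)
Lemma modn_sum_expn_mul k q n v m : prime q -> (n ^ q)%N = 1%N %[mod k] ->
  ~~ (q %| v)%N ->
  (\sum_(h < q * m) n ^ (v * h))%N = (m * \sum_(0 <= h < q) n ^ h)%N %[mod k].
Proof.
move=> q_prime nq q'v.
have nX x : (n ^ (q * x) = 1 %[mod k])%N.
  by rewrite expnM -modnXm nq modnXm exp1n.
have nmod x : (n ^ x = n ^ (x %% q) %[mod k])%N.
  by rewrite {1}(divn_eq x q) expnD mulnC [(_ * q)%N]mulnC -modnMmr nX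
    modnMmr muln1.
have ltq x : (x %% q < q)%N by rewrite ltn_mod prime_gt0.
have inj_v : injective (fun h : 'I_q => Ordinal (ltq (v * h)%N)).
  move=> h h' /(congr1 val) /= /eqP; wlog le_h: h h' / (h <= h')%N.
    move=> IH; case/orP: (leq_total h h') => le_h; first exact: IH.
    by rewrite eq_sym => /(IH _ _ le_h).
  rewrite eq_sym eqn_mod_dvd ?leq_mul2l ?le_h ?orbT // -mulnBr Euclid_dvdM //
    (negbTE q'v) /= => q_h.
  apply/val_inj/eqP; rewrite eqn_leq le_h -subn_eq0 /=.
  by apply: contraLR q_h; rewrite -lt0n => ?;
    rewrite gtnNdvd // ltn_subLR // ltn_addl.
have sum_q : (\sum_(h < q) n ^ (v * h) = \sum_(0 <= h < q) n ^ h %[mod k])%N.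
  rewrite big_mkord [in RHS](reindex_inj inj_v) -modn_summ -[in RHS]modn_summ.
  by congr (_ %% k)%N; apply: eq_bigr => h _; rewrite /= -nmod.
elim: m => [|m IHm]; first by rewrite muln0 big_ord0.
rewrite mulnS addnC big_split_ord /= mulSn addnC -modnDm IHm.
have -> : (\sum_(h < q) n ^ (v * (q * m + h))
           = \sum_(0 <= h < q) n ^ h %[mod k])%N.
  rewrite -sum_q -modn_summ -[in RHS]modn_summ; congr (_ %% k)%N.
  by apply: eq_bigr => h _;
    rewrite mulnDr expnD mulnCA -modnMml nX modnMml mul1n.
by rewrite modnDm.
Qed.

Lemma expn_mod1 k x y d : (x ^ d)%N = 1%N %[mod k] -> (d %| y)%N ->
  (x ^ y)%N = 1%N %[mod k].
Proof.
by move=> xd /dvdnP[z ->]; rewrite mulnC expnM -modnXm xd modnXm exp1n.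
Qed.

(** * Normal form and centralizers in the semidirect product *)

Section Semidirect.
Variables (k q l n : nat) (gT : finGroupType) (a b : gT).
Local Notation c := (q * l)%N.
Hypotheses (l_gt0 : (0 < l)%N) (q_prime : prime q).
Hypotheses (nq_mod : (n ^ q)%N = 1%N %[mod k]) (k_gt1 : (1 < k)%N).
Hypothesis G_ab : semidirect_gens k n c a b.

Let c_gt1 : (1 < c)%N.
Proof. by rewrite (leq_trans (prime_gt1 q_prime)) ?leq_pmulr. Qed.

Let ak1 : (a ^+ k = 1)%g. Proof. by case: G_ab. Qed.
Let bc1 : (b ^+ c = 1)%g. Proof. by case: G_ab. Qed.

Let conj_ab : (a ^ b^-1 = a ^+ n)%g.
Proof. by rewrite conjgE invgK mulgA; case: G_ab. Qed.

Lemma semidirect_mulXX u v : (b ^+ v * a ^+ u = a ^+ (u * n ^ v) * b ^+ v)%g.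
Proof.
elim: v u => [|v IHv] u; first by rewrite !expg0 expn0 muln1 mul1g mulg1.
rewrite expgSr -mulgA.
have -> : (b * a ^+ u = a ^+ (u * n) * b)%g.
  apply: (mulIg b^-1%g); rewrite mulgK mulnC expgM -conj_ab -conjXg conjgE.
  by rewrite invgK mulgA.
by rewrite mulgA IHv -mulgA -mulnA -expnS.
Qed.

Lemma semidirect_mulX u v m :
  ((a ^+ u * b ^+ v) ^+ m =
     a ^+ (u * \sum_(h < m) n ^ (v * h)) * b ^+ (v * m))%g.
Proof.
elim: m => [|m IHm]; first by rewrite big_ord0 !muln0 !expg0 mulg1.
rewrite expgSr IHm big_ord_recr /= mulnDr expgD mulnS addnC expgD -!mulgA.
by congr (_ * _)%g; rewrite !mulgA semidirect_mulXX.
Qed.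

Lemma semidirect_surj (z : gT) :
  exists w : 'I_k * 'I_c, z = (a ^+ w.1 * b ^+ w.2)%g.
Proof.
have: z \in (<[a]> * <[b]>)%g.
  rewrite -norm_joinEr; last first.
    rewrite cycle_subG -groupV inE -cycleJ conj_ab.
    by rewrite cycle_subG mem_cycle.
  rewrite joing_idl joing_idr.
  by case: G_ab => _ eqG _ _ _; move: (in_setT z); rewrite -eqG.
case/mulsgP=> _ _ /cycleP[u ->] /cycleP[v ->] ->.
exists (Ordinal (ltn_pmod u (ltnW k_gt1)), Ordinal (ltn_pmod v (ltnW c_gt1))).
by rewrite /= !expg_mod.
Qed.

(** The map is onto, and the permutation model shows that the group has at least as many elements as
    there are pairs of exponents. *)
Lemma semidirect_bij :
  bijective (fun w : 'I_k * 'I_c => (a ^+ w.1 * b ^+ w.2)%g).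
Proof.
set f := fun w => _; have surjf : codom f =i predT.
  by move=> z; have [w ->] := semidirect_surj z; apply: codom_f f w.
have leG : (#|{: 'I_k * 'I_c}| <= #|gT|)%N.
  rewrite card_prod !card_ord; apply: semidirect_gens_card G_ab => //.
  by apply: expn_mod1 nq_mod _; rewrite dvdn_mulr.
have /image_injP injf : #|image f {: 'I_k * 'I_c}| == #|{: 'I_k * 'I_c}|.
  by rewrite eqn_leq leq_image_card (eq_card surjf).
apply: inj_card_bij => [x y|]; first exact: injf.
by rewrite -(eq_card surjf) leq_image_card.
Qed.

Lemma semidirect_eq u v u' v' :
  (a ^+ u * b ^+ v == a ^+ u' * b ^+ v')%g =
    (u == u' %[mod k])%N && (v == v' %[mod c])%N.
Proof.
rewrite -(expg_mod u ak1) -(expg_mod v bc1) -(expg_mod u' ak1) -(expg_mod v'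
  bc1).
have ltk x : (x %% k < k)%N by rewrite ltn_mod ltnW.
have ltc x : (x %% c < c)%N by rewrite ltn_mod ltnW.
have := inj_eq (bij_inj semidirect_bij) (Ordinal (ltk u), Ordinal (ltc v))
  (Ordinal (ltk u'), Ordinal (ltc v')).
by rewrite /= => ->; rewrite xpair_eqE -!val_eqE.
Qed.

Lemma semidirect_sum (V : nmodType) (P : pred gT) (f : gT -> V) :
  \sum_(z | P z) f z = \sum_(u < k) \sum_(v < c | P (a ^+ u * b ^+ v)%g)
    f (a ^+ u * b ^+ v)%g.
Proof.
rewrite (reindex _ (onW_bij _ semidirect_bij)) /= .
by rewrite pair_big_dep /=.
Qed.


Lemma semidirect_central v (z : gT) : (q %| v)%N -> commute (b ^+ v)%g z.
Proof.
move=> q_v; have [w ->] := semidirect_surj z.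
apply: commuteM; last by apply: commuteX2.
rewrite /commute semidirect_mulXX -(expg_mod (_ * _) ak1) -modnMmr.
by rewrite (expn_mod1 nq_mod q_v) modnMmr muln1 expg_mod.
Qed.

Variables i j : nat.
Hypotheses (q_j : (q %| j)%N).
Hypothesis ai_noncentral : (a ^+ i)%g \notin 'Z([set: gT])%g.
Local Notation t := (a ^+ i * b ^+ j)%g.
Local Notation d := (\sum_(0 <= h < q) n ^ h)%N.

(** If [q] does not divide [v], Bezout gives w v = w' q + 1, so b^(w v) is [b] times a central
    element. Then a^i would commute with [b], hence with the whole group, against
    [ai_noncentral]. *)
Lemma commute_semidirect_gens v :
  commute (a ^+ i)%g (b ^+ v)%g <-> (q %| v)%N.
Proof.
split=> [cab | q_v]; last exact/commute_sym/semidirect_central.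
apply: contraR ai_noncentral => q'v.
have v_gt0 : (0 < v)%N by case: v q'v {cab} => //; rewrite dvdn0.
have /eqP co_vq : coprime v q by rewrite coprime_sym prime_coprime.
have [w w' def_w _] := egcdnP q v_gt0; rewrite co_vq in def_w.
have cab1 : commute (a ^+ i)%g b.
  have := commuteX w cab; rewrite -expgM mulnC def_w expgD expg1 => cabw.
  have cq : commute (a ^+ i)%g (b ^+ (w' * q))%g.
    by apply/commute_sym/semidirect_central; rewrite dvdn_mull.
  apply: (mulgI (b ^+ (w' * q))%g).
  by move: cabw; rewrite /commute !mulgA -cq.
apply/centerP; split=> [|z _]; first by rewrite inE.
have [u ->] := semidirect_surj z.
by apply: commuteM; [apply: commuteX2 | apply: commuteX].
Qed.

(** Since b^j is central and a^u commutes with a^i, only the commutation of b^v with a^i is at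
    stake. *)
Lemma cent1_semidirect u v : ((a ^+ u * b ^+ v)%g \in 'C[t]%g) = (q %| v)%N.
Proof.
have cbj := semidirect_central _ q_j.
apply/cent1P/idP => [ct | q_v].
  apply/commute_semidirect_gens.
  have := commuteM ct (commuteV (commute_sym (cbj _)));
    rewrite mulgK => /commute_sym.
  have aia : commute (a ^+ i)%g (a ^+ u)%g by apply: commuteX2.
  by move/(commuteM (commuteV aia)); rewrite mulKg.
apply: commute_sym; apply: commuteM; last exact/commute_sym/semidirect_central.
by apply/commute_sym; apply: commuteM;
  [apply: commuteX2 | apply/commute_sym/cbj].
Qed.

Lemma card_cent1_semidirect : #|'C[t]%g| = (k * l)%N.
Proof.
rewrite -sum1_card semidirect_sum /=.
under eq_bigr => u _.
  under eq_bigl => v do rewrite cent1_semidirect.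
  rewrite (sum_ord_multiples _ (fun=> 1%N)) ?prime_gt0 // sum1_card card_ord.
  over.
by rewrite sum_nat_const card_ord.
Qed.

(** The central factor b^j splits off as b^(j m). In normal form the exponents of [a] are (i + u) S
    and u S with the same S, so [u] cancels. *)
Lemma cent_power_cond u v m :
  ((t * (a ^+ u * b ^+ v)) ^+ m == (a ^+ u * b ^+ v) ^+ m)%g =
    (k %| i * \sum_(h < m) n ^ (v * h))%N && (c %| j * m)%N.
Proof.
have -> : (t * (a ^+ u * b ^+ v) = (a ^+ (i + u) * b ^+ v) * b ^+ j)%g.
  by rewrite -[LHS]mulgA [(b ^+ j * _)%g]semidirect_central // expgD !mulgA.
rewrite expgMn; last exact/commute_sym/semidirect_central.
rewrite !semidirect_mulX -mulgA -!expgM -expgD semidirect_eq.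
have eq_dvd d x y : (x + y == y %[mod d])%N = (d %| x)%N.
  by rewrite -[X in _ == X %[mod d]]add0n eqn_modDr mod0n.
by rewrite mulnDl eq_dvd [(v * m + _)%N]addnC eq_dvd.
Qed.

(** The hypothesis says (a^i b^v)^m = (b^v)^m, so [expMg_eqXr_cent] makes b^(v m) commute with a^i.
    This keeps z^m inside the subgroup where the character is known. *)
Lemma cent_power_dvdn v m :
  (k %| i * \sum_(h < m) n ^ (v * h))%N -> (q %| v * m)%N.
Proof.
case/dvdnP=> x def_iS; apply/commute_semidirect_gens/commute_sym/cent1P.
rewrite expgM; apply: expMg_eqXr_cent.
by rewrite semidirect_mulX def_iS mulnC expgM ak1 expg1n mul1g expgM.
Qed.

(** * The character sum over the solutions of (t z)^m = z^m *)

Section Sum.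
Variables (F : fieldType) (chi : gT -> F) (f g : F).
Hypotheses (fk1 : f ^+ k = 1) (gl1 : g ^+ l = 1).
Hypothesis chiE : forall x y, chi (a ^+ x * b ^+ (q * y))%g = f ^+ x * g ^+ y.

Local Notation powers_sum m :=
  (\sum_(z | ((t * z) ^+ m == z ^+ m)%g) chi (z ^+ m)%g).

Lemma powers_sumE m : powers_sum m =
  k%:R * \sum_(v < c | [&& (c %| j * m)%N,
                            (k %| i * \sum_(h < m) n ^ (v * h))%N
                          & f ^+ (\sum_(h < m) n ^ (v * h))%N == 1])
    g ^+ (v * m %/ q).
Proof.
rewrite semidirect_sum (exchange_big_dep xpredT) //= mulr_sumr.
rewrite [RHS]big_mkcond; apply: eq_bigr => v _ /=.
under eq_bigl => u do rewrite cent_power_cond andbC.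
case: andP => [[c_jm k_iS]|]; last first.
  by rewrite big_pred0_eq; case: ifP => // /and3P[-> ->] _ [].
(* Now z^m is a power of [a] times a power of b^q, so [chiE] applies. *)
have q_vm := cent_power_dvdn k_iS.
rewrite c_jm k_iS /=; set S := (\sum_(h < m) _)%N.
under eq_bigr => u _.
  rewrite semidirect_mulX -{1}(divnK q_vm) [(_ %/ q * q)%N]mulnC chiE mulnC
    exprM.
  over.
(* The sum over [u] is geometric with ratio f^S, a k-th root of unity. *)
rewrite -mulr_suml sum_expr_unity;
  last by rewrite -exprM mulnC exprM fk1 expr1n.
by case: ifP => //; rewrite mul0r.
Qed.

(** This joins the solvability condition on S to the condition that the geometric sum over [u]
    survives. Both depend only on S modulo [k]. *)
Let period S := (k %| i * S)%N && (f ^+ S == 1).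

Let period_mod S S' : S = S' %[mod k] -> period S = period S'.
Proof.
move=> eqS; congr (_ && _); first by rewrite /dvdn -modnMmr eqS modnMmr.
by rewrite -(expr_mod S fk1) eqS expr_mod.
Qed.

Let period_dvd v m : (q %| v)%N -> period (\sum_(h < m) n ^ (v * h)) = period m.
Proof.
move=> q_v; apply: period_mod; under eq_bigr do rewrite expnM.
exact/modn_sum_expn/(expn_mod1 nq_mod).
Qed.

Let expr_period w : (g ^+ w) ^+ l = 1.
Proof. by rewrite -exprM mulnC exprM gl1 expr1n. Qed.

(** By [cent_power_dvdn] only multiples v = q w contribute, and for these S is congruent to [m].
    What remains is the sum of (g^m)^w over w < l. *)
Lemma powers_sum_ndvd m : ~~ (q %| m)%N -> powers_sum m =
  if [&& (c %| j * m)%N, (k %| i * m)%N, f ^+ m == 1 & g ^+ m == 1]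
  then (k * l)%:R else 0.
Proof.
move=> q'm; rewrite powers_sumE.
rewrite (eq_bigl (fun v : 'I_c => (q %| v)%N && ((c %| j * m)%N && period m))).
  rewrite [X in if X then _ else _](_ : _ =
      ((c %| j * m)%N && period m) && (g ^+ m == 1)).
    case: (_ && period m) => /=; last first.
      by rewrite big_pred0 ?mulr0 // => v; rewrite andbF.
    under eq_bigl do rewrite andbT.
    rewrite (sum_ord_multiples _ (fun v => g ^+ (v * m %/ q))) ?prime_gt0 //.
    under eq_bigr => v _ do rewrite -mulnA mulKn ?prime_gt0 // mulnC exprM.
    by rewrite sum_expr_unity // natrM; case: ifP; rewrite ?mulr0.
  by rewrite /period !andbA.
move=> v; rewrite /= -/(period _) andbCA; congr (_ && _).
have [q_v | q'v] := boolP (q %| v)%N; first by rewrite period_dvd.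
apply/negP => /andP[/cent_power_dvdn].
by rewrite Euclid_dvdM // (negbTE q'v) (negbTE q'm).
Qed.

(** The exponent is q m: S is congruent to q m when [q] divides [v], and to m d otherwise. So the
    condition [B] is summed over all v < ql with ratio g^m, and the correction [A] - [B] over the
    multiples of [q] with ratio g^(q m). *)
Lemma powers_sum_dvd m : powers_sum (q * m) =
  if (c %| j * (q * m))%N then
    let A := (k %| i * (q * m))%N && (f ^+ (q * m) == 1) in
    let B := (k %| i * (m * d))%N && (f ^+ (m * d) == 1) in
    (k * l)%:R * (q%:R * (B && (g ^+ m == 1))%:R
                  + (A%:R - B%:R) * (g ^+ (q * m) == 1)%:R)
  else 0.
Proof.
rewrite powers_sumE; case: ifP => c_jm; last by rewrite big_pred0 ?mulr0.
rewrite /= -!/(period _) natrM -mulrA; congr (_ * _).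
have gmc : (g ^+ m) ^+ c = 1 by rewrite mulnC exprM expr_period expr1n.
transitivity (\sum_(v < c) (period (m * d))%:R * (g ^+ m) ^+ v
   + \sum_(v < c | (q %| v)%N)
       ((period (q * m))%:R - (period (m * d))%:R) * (g ^+ m) ^+ v).
  rewrite big_mkcond [X in _ = _ + X]big_mkcond -big_split;
    apply: eq_bigr => v _ /=.
  rewrite -/(period _) mulnCA mulKn ?prime_gt0 // [(v * m)%N]mulnC exprM.
  have [q_v | q'v] := boolP (q %| v)%N.
    by rewrite period_dvd // -mulrDl addrC subrK; case: (period _);
      rewrite ?mul1r ?mul0r.
  rewrite (period_mod (modn_sum_expn_mul m q_prime nq_mod q'v)) addr0.
  by case: (period _); rewrite ?mul1r ?mul0r.
rewrite -mulr_sumr sum_expr_unity //.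
rewrite (sum_ord_multiples _ (fun v => _ * (g ^+ m) ^+ v)) ?prime_gt0 //.
under [X in _ + X]eq_bigr => v _ do rewrite exprM.
rewrite -mulr_sumr -[(_ ^+ m) ^+ q]exprM [(m * q)%N]mulnC sum_expr_unity //.
case: (period (m * d)); case: (g ^+ m == 1); case: (_ == 1);
  rewrite /= ?natrM; ring.
Qed.

End Sum.
End Semidirect.

(** * Integer exponents and the case tables *)

(** If [q] does not divide [k], then [k] already divides [x]. Otherwise n^q = 1 modulo [q], so n = 1
    modulo [q] by Fermat, and the sum of the n^h is a multiple of [q]. *)
Lemma dvdn_mul_sum_expn k q n x : prime q -> (n ^ q)%N = 1%N %[mod k] ->
  (k %| q * x)%N -> (k %| x * \sum_(0 <= h < q) n ^ h)%N.
Proof.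
move=> q_prime nq k_qx; have [q_k | q'k] := boolP (q %| k)%N; last first.
  by rewrite dvdn_mulr // -(Gauss_dvdr _ (n := q)) // coprime_sym prime_coprime.
rewrite (dvdn_trans k_qx) // mulnC dvdn_mul //.
have n1 : n = 1%N %[mod q].
  by rewrite -(fermat_little n q_prime) -[LHS](modn_dvdm _ q_k) nq modn_dvdm.
by rewrite /dvdn big_mkord modn_sum_expn // modnn.
Qed.

Lemma expgz_nat (gT : finGroupType) (x : gT) N z :
  (0 < N)%N -> (x ^+ N = 1)%g ->
  exists2 z0 : nat, (N%:Z %| z - z0%:Z)%Z & expgz x z = (x ^+ z0)%g.
Proof.
move=> N_gt0 xN; case: z => z; first by exists z; rewrite ?subrr ?dvdz0.
(* [Negz z] is -(z + 1), and -1 is congruent to N - 1. *)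
exists (z.+1 * N.-1)%N.
  apply/dvdzP; exists (- z.+1%:Z); rewrite NegzE -[in RHS](prednK N_gt0); lia.
apply: (mulIg (x ^+ z.+1)%g); rewrite /= mulVg -expgD addnC -mulnS prednK //.
by rewrite mulnC expgM xN expg1n.
Qed.

Lemma dvdz_mul_nat (N x : nat) (z : int) (z0 : nat) :
  (N%:Z %| z - z0%:Z)%Z -> (N%:Z %| x%:Z * z)%Z = (N %| z0 * x)%N.
Proof.
move=> N_z; rewrite -[z in LHS](subrK z0%:Z) mulrDr.
rewrite (rpredDl _ (dvdz_mull _ N_z)).
by rewrite dvdzE abszM mulnC.
Qed.

Lemma prim_expz_eq1 (F : fieldType) N (mu : F) (z : int) : N.-primitive_root mu
  ->
  (mu ^ z == 1) = (N%:Z %| z)%Z.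
Proof.
move=> muP; case: z => z; first by rewrite -exprnP -(prim_order_dvd muP).
by rewrite -[mu ^ _]/(mu ^- z.+1) invr_eq1 -(prim_order_dvd muP) dvdzE.
Qed.

Theorem theorem4p4 (R : realType) (k q l n : nat)
    (k_gt0 : (0 < k)%N) (q_gt0 : (0 < q)%N) (l_gt0 : (0 < l)%N)
    (n_gt0 : (0 < n)%N)
    (q_prime : prime q) (q_dvd_Aut : (q %| #|Aut (Zp k)|)%N)
    (nq_mod : (n ^ q)%N = 1%N %[mod k]) (n_mod : n <> 1%N %[mod k])
    (gT : finGroupType) (a b : gT)
    (G_ab : semidirect_gens k n (q * l) a b)
    (mu_k mu_l : R[i])
    (mu_kP : k.-primitive_root mu_k) (mu_lP : l.-primitive_root mu_l)
    (i j r s : int)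
    (ai_noncentral : expgz a i \notin 'Z([set: gT])%g)
    (q_dvd_j : (q%:Z %| j)%Z)
    (e : nat)
    (rho : mx_representation R[i] 'C[expgz a i * expgz b j]%g e)
    (rho_irr : mx_irreducible rho)
    (rho_char : forall x y : int,
       \tr (rho (expgz a x * expgz b (q%:Z * y))%g)
         = mu_k ^ (r * x) * mu_l ^ (s * y))
    (g : class_reps (expgz a i * expgz b j)%g)
    (m : nat) (m_gt0 : (0 < m)%N) :
  let d : nat := (\sum_(0 <= h < q) n ^ h)%N in
  let nu := indicator m (class_module g rho) in
  let kmi := (k%:Z %| m%:Z * i)%Z in
  let kmr := (k%:Z %| m%:Z * r)%Z in
  let kqmdi := (k%:Z * q%:Z %| m%:Z * d%:Z * i)%Z in
  let kqmdr := (k%:Z * q%:Z %| m%:Z * d%:Z * r)%Z in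
  let lms := (l%:Z %| m%:Z * s)%Z in
  let lqms := (l%:Z * q%:Z %| m%:Z * s)%Z in
  let qlmj := (q%:Z * l%:Z %| m%:Z * j)%Z in
  [/\ ~~ qlmj -> nu = 0,
      ~~ (q %| l)%N -> qlmj ->
      nu = if [&& (q %| m)%N, kmi, kmr & lqms] then q%:R
           else if [&& (q %| m)%N, ~~ kmi || ~~ kmr, kqmdi, kqmdr & lqms]
                then q%:R - 1
           else if [&& ~~ (q %| m)%N || ~~ lqms, kmi, kmr & lms] then 1
           else 0
    & (q %| l)%N -> qlmj ->
      nu = if [&& (q %| m)%N, kmi, kmr & lqms] then q%:R
           else if [&& (q %| m)%N, ~~ kmr || ~~ kmi, kqmdi, kqmdr & lqms]
                then q%:R - 1
           else if [&& ~~ (q %| m)%N, kmi, kmr & lms] then 1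
           else if [&& (q %| m)%N, ~~ kmi || ~~ kmr, ~~ lqms, kqmdi, kqmdr & lms]
                then -1
           else 0].

Proof.
have k_gt1 : (1 < k)%N.
  rewrite ltn_neqAle k_gt0 andbT; apply: contra_not_neq n_mod => <-.
  by rewrite !modn1.
have [_ _ ak bc _] := G_ab.
have c_gt0 : (0 < q * l)%N by rewrite muln_gt0 q_gt0.
have [i0 k_i ai] := expgz_nat i k_gt0 ak.
have [j0 c_j bj] := expgz_nat j c_gt0 bc.
have q_j0 : (q %| j0)%N.
  have q_jj0 : (q%:Z %| j - j0%:Z)%Z.
    by rewrite (dvdz_trans _ c_j) // PoszM dvdz_mulr.
  by have := rpredB q_dvd_j q_jj0; rewrite opprB addrC subrK.
set f := mu_k ^ r; set h := mu_l ^ s; pose chi z := \tr (rho z).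
have chiE x y : chi (a ^+ x * b ^+ (q * y))%g = f ^+ x * h ^+ y.
  by rewrite [LHS](rho_char x y) !exprnP !exprz_exp.
have fk : f ^+ k = 1.
  by rewrite exprnP exprzAC -exprnP (prim_expr_order mu_kP) exp1rz.
have hl : h ^+ l = 1.
  by rewrite exprnP exprzAC -exprnP (prim_expr_order mu_lP) exp1rz.
move=> d nu kmi kmr kqmdi kqmdr lms lqms qlmj.
have kl0 : (k * l)%:R != 0 :> R[i].
  by rewrite Num.Theory.pnatr_eq0 -lt0n muln_gt0 k_gt0.
have aN : (a ^+ i0)%g \notin 'Z([set: gT])%g by rewrite -ai.
have nuE : nu = (k * l)%:R^-1
    * \sum_(z | (((a ^+ i0 * b ^+ j0) * z) ^+ m == z ^+ m)%g) chi (z ^+ m)%g.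
  rewrite -(card_cent1_semidirect l_gt0 q_prime nq_mod k_gt1 G_ab q_j0 aN) -ai
    -bj.
  apply: class_module_indicator; rewrite Num.Theory.pnatr_eq0 -lt0n.
  by apply/card_gt0P; exists 1%g.
have def_qlmj : qlmj = (q * l %| j0 * m)%N.
  by rewrite -(dvdz_mul_nat _ c_j) PoszM.
have def_kmi : kmi = (k %| i0 * m)%N by rewrite -(dvdz_mul_nat _ k_i).
have def_kmr : kmr = (f ^+ m == 1).
  by rewrite exprnP exprz_exp (prim_expz_eq1 _ mu_kP) mulrC.
have def_lms : lms = (h ^+ m == 1).
  by rewrite exprnP exprz_exp (prim_expz_eq1 _ mu_lP) mulrC.
have PS := powers_sum_dvd l_gt0 q_prime nq_mod k_gt1 G_ab q_j0 aN fk hl chiE.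
(* When [q] does not divide [m], the indicator is 0 or 1 and only the rows of the tables allowing
   such an [m] are left. *)
have [q_m | q'm] := boolP (q %| m)%N; last first.
  have {}nuE : nu = [&& qlmj, kmi, kmr & lms]%:R.
    rewrite nuE (powers_sum_ndvd l_gt0 q_prime nq_mod k_gt1 G_ab q_j0 aN fk hl
      chiE) //.
    rewrite -def_qlmj -def_kmi -def_kmr -def_lms.
    by case: ifP; rewrite ?mulr0 // mulVf.
  rewrite nuE; split=> [/negbTE-> // | _ -> | _ ->] /=; first by case: ifP.
  by case: ifP.
(* Writing m = q m' lets the factor [q] cancel from the divisibilities by kq and lq, which become
   conditions on m'. *)
have [m' def_m] : exists m', m = (q * m')%N.
  by case/dvdnP: q_m => m' ->; exists m'; rewrite mulnC.
have q0 : q%:Z != 0 by rewrite -lt0n.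
have def_kqmdi : kqmdi = (k %| i0 * (m' * d))%N.
  rewrite -(dvdz_mul_nat _ k_i) -(dvdz_mul2r q0); congr (_ %| _)%Z.
  by rewrite def_m !PoszM; ring.
have kqmdrE : kqmdr = (k%:Z %| (m' * d)%N%:Z * r)%Z.
  by rewrite -(dvdz_mul2r q0); congr (_ %| _)%Z; rewrite def_m !PoszM; ring.
have lqmsE : lqms = (l%:Z %| m'%:Z * s)%Z.
  by rewrite -(dvdz_mul2r q0); congr (_ %| _)%Z; rewrite def_m !PoszM; ring.
have def_kqmdr : kqmdr = (f ^+ (m' * d) == 1).
  by rewrite kqmdrE exprnP exprz_exp (prim_expz_eq1 _ mu_kP) mulrC.
have def_lqms : lqms = (h ^+ m' == 1).
  by rewrite lqmsE exprnP exprz_exp (prim_expz_eq1 _ mu_lP) mulrC.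
have {PS}nuE : nu = qlmj%:R * (q%:R * ((kqmdi && kqmdr) && lqms)%:R
    + ((kmi && kmr)%:R - (kqmdi && kqmdr)%:R) * lms%:R).
  rewrite nuE def_qlmj def_kmi def_kmr def_kqmdi def_kqmdr def_lqms def_lms.
  rewrite def_m PS /=; case: ifP;
    rewrite ?mulr0 ?mul0r // mul1r mulrA mulVf ?mul1r //.
(* The next four implications tie the divisibility conditions together. The first two say that the
   condition at q m' implies the one at m' d. *)
have dvdW x : (k %| x * m)%N -> (k %| x * (m' * d))%N.
  by rewrite def_m mulnCA [(x * (_ * d))%N]mulnA; apply: dvdn_mul_sum_expn.
have kmiW : kmi -> kqmdi by rewrite def_kmi def_kqmdi; apply: dvdW.
have kmrW : kmr -> kqmdr.
  (* Only the natural number congruent to [r] modulo [k] is wanted here; the power of [a] is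
     discarded. *)
  have [r0 k_r _] := expgz_nat r k_gt0 ak.
  by rewrite /kmr kqmdrE !(dvdz_mul_nat _ k_r); apply: dvdW.
have lqmsW : lqms -> lms.
  by rewrite def_lqms def_lms def_m mulnC exprM => /eqP->; rewrite expr1n.
(* For [l] prime to [q] the two conditions on [s] coincide, which excludes the value -1 in case
   (ii). *)
have lmsW : ~~ (q %| l)%N -> lms -> lqms.
  move=> q'l; rewrite lqmsE /lms def_m PoszM -mulrA Gauss_dvdzr //.
  by rewrite coprimezE coprime_sym prime_coprime.
clearbody nu kmi kmr kqmdi kqmdr lms lqms qlmj.
move: nuE kmiW kmrW lqmsW lmsW; clear=> ->.
(* The tables are now compared with the closed formula over all values of eight booleans; the
   implications discard the impossible combinations. *)
case: (q %| l)%N; case: qlmj; case: kmi; case: kmr; case: kqmdi; case: kqmdr;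
  case: lms; case: lqms => //= kmiW kmrW lqmsW lmsW;
  try (by have := kmiW isT); try (by have := kmrW isT);
    try (by have := lqmsW isT);
  try (by have := lmsW isT isT); split=> //=; do ?[move=> _]; ring.
Qed.
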